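(* For every integer $n$ with $6\le n\le 11$, there exists a graph of order $n$ and size $\mathrm{ex}(n,C_4)+1$ which contains exactly one copy of $C_4$. For $n=12$ and for $n=13$, the minimum number of copies of $C_4$ in a graph of order $n$ and size $\mathrm{ex}(n,C_4)+1$ is $2$.
   Context: All graphs are finite and simple. The order of a graph is its number of vertices and its size is its number of edges. $C_4$ denotes the cycle of length 4. A copy of $H$ in $G$ is a subgraph of $G$ isomorphic to $H$; the number of copies of $H$ in $G$ is the number of distinct subgraphs of $G$ isomorphic to $H$. For a graph $H$ and a positive integer $n$, the Turán number $\mathrm{ex}(n,H)$ is the maximum size of a simple graph of order $n$ containing no copy of $H$. (Known values: $\mathrm{ex}(6,C_4)=7$, $\mathrm{ex}(7,C_4)=9$, $\mathrm{ex}(8,C_4)=11$, $\mathrm{ex}(9,C_4)=13$, $\mathrm{ex}(10,C_4)=16$, $\mathrm{ex}(11,C_4)=18$, $\mathrm{ex}(12,C_4)=21$, $\mathrm{ex}(13,C_4)=24$.) *)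

(* Defs.v *)
From mathcomp Require Import all_boot.
Set Implicit Arguments. Unset Strict Implicit. Unset Printing Implicit Defensive.

Definition graph (n : nat) := {set {set 'I_n}}.

Definition simple_graph n (E : graph n) : bool :=
  [forall e in E, #|e| == 2].

Definition gsize n (E : graph n) : nat := #|E|.

Definition cyc4 n (a b c d : 'I_n) : graph n :=
  [set [set a; b]; [set b; c]; [set c; d]; [set d; a]].

(* S is the edge set of a 4-cycle on four distinct vertices. A copy of C4
   (a subgraph isomorphic to C4) has no isolated vertices, so it is
   determined by its edge set. *)
Definition is_C4 n (S : graph n) : bool :=
  [exists a : 'I_n, exists b : 'I_n, exists c : 'I_n, exists d : 'I_n,
     [&& uniq [:: a; b; c; d] & S == cyc4 a b c d]].

Definition numC4 n (E : graph n) : nat :=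
  #|[set S : graph n | (S \subset E) && is_C4 S]|.

Definition exC4 (n : nat) : nat :=
  \max_(E : graph n | simple_graph E && (numC4 E == 0)) gsize E.

(* Main.v *)
(** Let [numC4 E <= 1] on [n] vertices with at least [min_edges n] edges.
    Deleting a vertex of minimum degree leaves a graph of the same kind on
    [n - 1] vertices, since the minimum degree is at most the average one.
    So all such graphs, up to isomorphism, arise from the empty graph by
    repeatedly adding a vertex of minimum degree. Generating them is a small
    computation (at most 216 graphs per level), in which level 12 turns out to
    be empty: with 22 edges on 12 vertices, or 25 on 13, there are two copies
    of C4. For [n <= 11] the generated graphs with more than ex(n, C4) edges all
    contain a C4. Explicit graphs give the remaining bounds.

    Copies of C4 are counted through codegrees: the sum of [k * (k - 1)] over
    ordered pairs of distinct vertices, with [k] their number of common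
    neighbours, counts labelled 4-cycles, hence equals [8 * numC4]. *)
Require Import Defs.
From mathcomp Require Import all_boot.
From mathcomp Require Import zify.
Set Implicit Arguments. Unset Strict Implicit. Unset Printing Implicit Defensive.

(** * The search *)

Definition matrix := seq (seq bool).
Definition dot (r r' : seq bool) := count (fun p => p.1 && p.2) (zip r r').
Definition degree_sum (M : matrix) := sumn [seq count id r | r <- M].
Definition codeg_sum (M : matrix) :=
  sumn [seq sumn [seq dot r r' * (dot r r').-1 | r' <- M] | r <- M].
(** The share of the pairs [r' = r] in [codeg_sum]. For an adjacency matrix, the excess of
    [codeg_sum] over it is 8 times the number of copies of C4. *)
Definition codeg_sum_diag (M : matrix) :=
  sumn [seq count id r * (count id r).-1 | r <- M].

Fixpoint rows n d : seq (seq bool) :=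
  if n is n'.+1 then
    [seq false :: r | r <- rows n' d] ++
    (if d is d'.+1 then [seq true :: r | r <- rows n' d'] else [::])
  else if d is 0 then [:: [::]] else [::].

Definition extend (r : seq bool) (M : matrix) : matrix :=
  (false :: r) :: [seq p.1 :: p.2 | p <- zip r M].

Definition relabel (p : seq nat) (M : matrix) : matrix :=
  [seq [seq nth false (nth [::] M i) j | j <- p] | i <- p].

Fixpoint lexlt (s t : seq nat) :=
  match s, t with
  | x :: s', y :: t' => (x < y) || ((x == y) && lexlt s' t')
  | [::], _ :: _ => true
  | _, [::] => false
  end.

(** The key of a vertex is its colour followed by the sorted colours of its neighbours; its new
    colour is the rank of that key. *)
Definition refine (M : matrix) (c : seq nat) : seq nat :=
  let k := [seq p.1 :: sort leq (mask p.2 c) | p <- zip c M] in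
  [seq count (fun y => lexlt y x) k | x <- k].

(* Sorts the vertices by an iterated degree-refinement colouring. This identifies
   most isomorphic matrices, and correctness only needs the output to be some
   relabelling of [M]. *)
Definition normalize (M : matrix) : matrix :=
  let c := iter 4 (refine M) (nseq (size M) 0) in
  relabel (sort (relpre (nth 0 c) leq) (iota 0 (size M))) M.

(* From 25 at [n = 13] downwards, the least integer that is at least
   [(n - 1) / (n + 1)] times the next entry, the proportion of edges left after
   deleting a vertex of at most average degree from [n + 1] vertices. *)
Definition min_edges n := nth 0 [:: 0; 0; 1; 2; 3; 5; 7; 9; 11; 13; 16; 19; 22; 25] n.

(** A new vertex of degree [d] raises each old degree by at most one, so it can have minimum degree
    only if all old degrees are at least [d - 1]. *)
Definition extensions n (M : matrix) : seq matrix :=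
  flatten [seq [seq extend r M | r <- rows n d]
     | d <- iota 0 n.+1 & (2 * min_edges n.+1 <= degree_sum M + 2 * d)
                          && all (fun r => d <= (count id r).+1) M].

(* The head row is the new vertex. Here and in [insert], [if] short-circuits
   under [vm_compute], which evaluates both arguments of [&&]. *)
Definition keep (M : matrix) : bool :=
  let d := count id (head [::] M) in
  if all (fun r => d <= count id r) M then codeg_sum M <= codeg_sum_diag M + 8 else false.

Fixpoint eq_seq T (eqT : T -> T -> bool) (s t : seq T) : bool :=
  match s, t with
  | x :: s', y :: t' => if eqT x y then eq_seq eqT s' t' else false
  | [::], [::] => true
  | _, _ => false
  end.

Fixpoint insert (M : matrix) (L : seq matrix) : seq matrix :=
  if L is N :: L' then
    if eq_seq (eq_seq eqb) M N then L else N :: insert M L'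
  else [:: M].

Definition next_level n (L : seq matrix) : seq matrix :=
  foldr insert [::] (flatten [seq [seq normalize N | N <- extensions n M & keep N] | M <- L]).

(** * Correctness of the search *)

Lemma eq_seqP T (eqT : T -> T -> bool) (s t : seq T) :
  (forall x y, eqT x y -> x = y) -> eq_seq eqT s t -> s = t.
Proof.
move=> eqTP; elim: s t => [|x s IHs] [|y t] //=.
by case: ifP => // /eqTP-> /IHs->.
Qed.

Lemma mem_insert M N L : N \in M :: L -> N \in insert M L.
Proof.
elim: L => [|K L IHL] //=; case: ifP => [MK|_].
  have -> : M = K.
    by apply: eq_seqP MK => r r'; apply: eq_seqP => -[] [].
  by rewrite !inE orbA orbb.
rewrite inE => /predU1P[NM|]; first by rewrite inE IHL ?orbT // NM mem_head.
rewrite inE => /predU1P[->|NL]; first exact: mem_head.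
by rewrite inE IHL ?orbT // inE NL orbT.
Qed.

Lemma mem_foldr_insert M L : M \in L -> M \in foldr insert [::] L.
Proof.
elim: L => //= K L IHL; rewrite inE => /orP[MK|/IHL ML]; apply: mem_insert.
  by rewrite inE MK.
by rewrite inE ML orbT.
Qed.

Lemma rows_complete (r : seq bool) : r \in rows (size r) (count id r).
Proof.
by elim: r => //= -[] r IHr /=; rewrite mem_cat map_f ?orbT.
Qed.

(** * Edges and labelled 4-cycles on a sequence of vertices *)

Section Relation.

Variables (V : eqType) (e : rel V).
Hypotheses (eC : symmetric e) (exx : irreflexive e).

Definition adjmx (s : seq V) : matrix := [seq [seq e x y | y <- s] | x <- s].
Definition codeg s x y := count (fun z => e x z && e y z) s.
Definition labelled_C4 (s : seq V) :=
  \sum_(x <- s) \sum_(y <- s | y != x) codeg s x y * (codeg s x y).-1.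
(** Each edge is counted at whichever of its ends comes first in [s]. *)
Fixpoint edges (s : seq V) := if s is x :: s' then count (e x) s' + edges s' else 0.

Lemma degree_sumE s : degree_sum (adjmx s) = \sum_(x <- s) count (e x) s.
Proof.
rewrite /degree_sum /adjmx sumnE !big_map; apply: eq_bigr => x _.
by rewrite count_map; apply: eq_count.
Qed.

Lemma degree_sum_edges s : degree_sum (adjmx s) = (edges s).*2.
Proof.
rewrite degree_sumE; elim: s => [|x s IHs] /=; first by rewrite big_nil.
have exs : \sum_(y <- s) e y x = count (e x) s.
  rewrite -sum1_count [RHS]big_mkcond /=.
  by apply: eq_bigr => y _; rewrite eC; case: (e x y).
by rewrite big_cons /= exx big_split /= exs IHs; lia.
Qed.

Lemma perm_edges s t : perm_eq s t -> edges s = edges t.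
Proof.
move=> st; apply: double_inj; rewrite -!degree_sum_edges !degree_sumE (perm_big _ st) /=.
by apply: eq_bigr => x _; apply/permP.
Qed.

Lemma perm_labelled_C4 s t : perm_eq s t -> labelled_C4 s = labelled_C4 t.
Proof.
move=> st; rewrite /labelled_C4 (perm_big _ st) /=; apply: eq_bigr => x _.
rewrite (perm_big _ st) /=; apply: eq_bigr => y _.
by rewrite /codeg (permP st).
Qed.

(** Deleting a vertex removes pairs and lowers codegrees, so having at most one C4 is inherited. *)
Lemma leq_labelled_C4_cons x s : labelled_C4 s <= labelled_C4 (x :: s).
Proof.
rewrite [X in _ <= X]/labelled_C4 big_cons; apply: leq_trans (leq_addl _ _).
apply: leq_sum => y _; rewrite big_cons.
apply: leq_trans (_ : _ <= \sum_(z <- s | z != y) _) _; last first.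
  by case: ifP => _; [apply: leq_addl | apply: leqnn].
apply: leq_sum => z _.
have le_cd : codeg s y z <= codeg (x :: s) y z by apply: leq_addl.
by apply: leq_mul => //; rewrite -!subn1 leq_sub2r.
Qed.

Lemma dot_adj s x y : dot [seq e x z | z <- s] [seq e y z | z <- s] = codeg s x y.
Proof. by rewrite /dot zip_map count_map; apply: eq_count. Qed.

Lemma codeg_sumE s :
  uniq s -> codeg_sum (adjmx s) = labelled_C4 s + codeg_sum_diag (adjmx s).
Proof.
move=> Us; rewrite /codeg_sum /codeg_sum_diag /labelled_C4 !sumnE !big_map -big_split /=.
rewrite big_seq_cond [RHS]big_seq_cond; apply: eq_bigr => x; rewrite andbT => xs.
rewrite sumnE !big_map (bigD1_seq x) //= addnC dot_adj; congr (_ + _).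
  by apply: eq_bigr => y _; rewrite dot_adj.
have -> // : codeg s x x = count id [seq e x y | y <- s].
by rewrite count_map; apply: eq_count => z /=; rewrite andbb.
Qed.

Lemma adjmx_cons x s : adjmx (x :: s) = extend [seq e x y | y <- s] (adjmx s).
Proof.
rewrite /adjmx /extend /= exx; congr (_ :: _).
by rewrite zip_map -map_comp; apply: eq_map => y /=; rewrite eC.
Qed.

Lemma relabel_adjmx x0 p s :
  all (fun i => i < size s) p ->
  relabel p (adjmx s) = adjmx [seq nth x0 s i | i <- p].
Proof.
move=> /allP ps; rewrite /relabel /adjmx -!map_comp; apply/eq_in_map => i /ps i_s /=.
rewrite -map_comp; apply/eq_in_map => j /ps j_s /=.
by rewrite (nth_map x0) // (nth_map x0).
Qed.

Lemma normalize_adjmx s :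
  exists2 t, perm_eq t s & normalize (adjmx s) = adjmx t.
Proof.
case: s => [|x0 s0]; first by exists [::].
set s := x0 :: s0; rewrite /normalize.
set p := sort _ _.
have p_iota : perm_eq p (iota 0 (size s)) by rewrite perm_sort size_map.
exists [seq nth x0 s i | i <- p].
  by rewrite -[X in perm_eq _ X](mkseq_nth x0 s) perm_map.
apply: relabel_adjmx; apply/allP => i.
by rewrite (perm_mem p_iota) mem_iota add0n.
Qed.

(** The bound 8 stands for one copy of C4, and the permutation [t] for an isomorphism. *)
Definition covers n (L : seq matrix) := forall s, uniq s -> size s = n ->
  min_edges n <= edges s -> labelled_C4 s <= 8 ->
  exists2 t, perm_eq t s & adjmx t \in L.

Lemma min_degree_vertex s : 0 < size s ->
  exists2 v, v \in s & {in s, forall x, count (e v) s <= count (e x) s}.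
Proof.
case: s => // x0 s _; set s' := x0 :: s.
pose P k := has (fun x => count (e x) s' == k) s'.
have exP : exists k, P k by exists (count (e x0) s'); rewrite /P /= eqxx.
case: (ex_minnP exP) => k /hasP[v vs /eqP <-] kmin.
by exists v => // x xs; apply: kmin; apply/hasP; exists x.
Qed.

Lemma next_level_covers n L :
  (min_edges n == 0) || (n.+1 * (min_edges n).-1 < n.-1 * min_edges n.+1) ->
  covers n L -> covers n.+1 (next_level n L).
Proof.
move=> avg covL s Us sz_s le_s Ws.
have [|v vs vmin] := @min_degree_vertex s; first by rewrite sz_s.
have s_perm := perm_to_rem vs; set s' := rem v s in s_perm.
set d := count (e v) s in vmin.
have dE : d = count (e v) s' by rewrite /d (permP s_perm) /= exx.
have es : edges s = d + edges s' by rewrite (perm_edges s_perm) /= -dE.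
have avg_d : n.+1 * d <= (edges s).*2.
  rewrite -degree_sum_edges degree_sumE -sz_s mulnC -iter_addn_0 -count_predT -big_const_seq.
  by rewrite big_seq_cond [leqRHS]big_seq_cond leq_sum // => x /andP[/vmin].
have s'W : labelled_C4 s' <= 8.
  by apply: leq_trans Ws; rewrite (perm_labelled_C4 s_perm) leq_labelled_C4_cons.
have sz_s' : size s' = n by rewrite size_rem // sz_s.
have le_s' : min_edges n <= edges s'.
  (* By [avg_d], [n.+1 * edges s'] is at least [n.-1 * edges s], which by [avg] exceeds
     [n.+1 * (min_edges n).-1]. *)
  by case/orP: avg => [/eqP->//|avg]; nia.
have [t t_s' tL] := covL s' (rem_uniq v Us) sz_s' le_s' s'W.
have vt_s : perm_eq (v :: t) s by rewrite perm_sym (perm_trans s_perm) // perm_cons perm_sym.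
have [u u_vt uE] := normalize_adjmx (v :: t).
exists u; first exact: perm_trans u_vt vt_s.
rewrite -uE /next_level; apply: mem_foldr_insert; apply/flattenP.
eexists; first by apply: map_f tL.
apply: map_f; rewrite mem_filter; apply/andP; split.
  have deg_row x : count id [seq e x y | y <- v :: t] = count (e x) s.
    by rewrite count_map -(permP vt_s); apply: eq_count.
  rewrite /keep ifT.
    rewrite codeg_sumE ?(perm_uniq vt_s) // addnC leq_add2l.
    by rewrite (perm_labelled_C4 vt_s).
  rewrite [head _ _]/= deg_row; apply/allP => r /mapP[x xvt ->].
  by rewrite deg_row vmin // -(perm_mem vt_s).
have dE' : count id [seq e v y | y <- t] = d.
  by rewrite count_map dE -(permP t_s'); apply: eq_count.
apply/flattenP; exists [seq extend r (adjmx t) | r <- rows n d]; last first.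
  rewrite adjmx_cons; apply: map_f; rewrite -dE'.
  by rewrite -sz_s' -(perm_size t_s') -(size_map (e v)) rows_complete.
apply: map_f; rewrite mem_filter mem_iota add0n; apply/andP; split; last first.
  by rewrite ltnS dE -sz_s' count_size.
apply/andP; split.
  by rewrite degree_sum_edges (perm_edges t_s'); lia.
apply/allP => r /mapP[x xt ->].
rewrite count_map; apply: leq_trans (vmin x _) _.
  by rewrite -(perm_mem vt_s) inE xt orbT.
(* The degrees of [x] in [s] and in [t] differ by the possible edge to [v]. *)
rewrite -(permP vt_s) /=; have -> : count (preim (e x) id) t = count (e x) t by exact: eq_count.
by case: (e x v).
Qed.

End Relation.

(** * Edges and 4-cycles of a graph *)

(** Double counting, used with fibres of size 2 over edges and of size 8 over copies of C4. *)
Lemma card_fibres (T U : finType) (f : T -> U) (A : {set T}) (B : {set U}) k :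
  {in A, forall x, f x \in B} ->
  {in B, forall y, #|[set x in A | f x == y]| = k} -> #|A| = #|B| * k.
Proof.
move=> fAB fib; rewrite -sum1_card (partition_big f (mem B)) //= -sum_nat_const.
apply: eq_bigr => y yB; rewrite -(fib y yB) -sum1_card.
by apply: eq_bigl => x; rewrite inE.
Qed.

Lemma set2_eq (T : finType) (a b x y : T) :
  ([set a; b] == [set x; y]) = ((a == x) && (b == y)) || ((a == y) && (b == x)).
Proof.
apply/eqP/orP => [ab_xy|[/andP[/eqP-> /eqP->]|/andP[/eqP-> /eqP->]]] //; last by rewrite setUC.
have /set2P xab : x \in [set a; b] by rewrite ab_xy set21.
have /set2P yab : y \in [set a; b] by rewrite ab_xy set22.
have /set2P axy : a \in [set x; y] by rewrite -ab_xy set21.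
have /set2P bxy : b \in [set x; y] by rewrite -ab_xy set22.
by case: axy xab yab bxy => ? [] ? [] ? [] ?; subst; rewrite !eqxx; auto.
Qed.

Lemma card_offdiag (T : finType) (A : {pred T}) :
  \sum_(x in A) \sum_(y in A | y != x) 1 = #|A| * #|A|.-1.
Proof.
rewrite -sum_nat_const; apply: eq_bigr => x xA.
rewrite sum1dep_card [in RHS](cardD1 x) xA /=.
by rewrite cardsE; apply: eq_card => y; rewrite !inE andbC.
Qed.

Section Graph.

Variables (n : nat) (E : graph n).

Definition adj : rel 'I_n := fun x y => [set x; y] \in E.

Lemma adjC : symmetric adj.
Proof. by move=> x y; rewrite /adj setUC. Qed.

Hypothesis sE : simple_graph E.

Lemma adjxx : irreflexive adj.
Proof.
move=> x; apply/negP => xxE.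
by have /forall_inP/(_ _ xxE) := sE; rewrite setUid cards1.
Qed.

Lemma adj_neq x y : adj x y -> x != y.
Proof. by apply: contraTneq => ->; rewrite adjxx. Qed.

Lemma edges_gsize : edges adj (enum 'I_n) = gsize E.
Proof.
(* Once doubled, both sides count ordered adjacent pairs. *)
apply/eqP; rewrite -(eqn_pmul2r (isT : 0 < 2)) muln2; apply/eqP.
rewrite -degree_sum_edges; [|exact: adjC|exact: adjxx].
rewrite degree_sumE.
transitivity #|[set p : 'I_n * 'I_n | adj p.1 p.2]|; last first.
  apply: (card_fibres (f := fun p => [set p.1; p.2])) => [p|S SE]; first by rewrite inE.
  have /forall_inP/(_ _ SE)/cards2P[a [b [ab Sab]]] := sE.
  rewrite (_ : [set _ in _ | _] = [set (a, b); (b, a)]).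
    by rewrite cards2 xpair_eqE negb_and ab.
  apply/setP => -[x y]; rewrite !inE /= Sab set2_eq !xpair_eqE.
  apply/andb_idl; rewrite -set2_eq /adj => /eqP->.
  by rewrite -Sab.
rewrite -sum1dep_card -(pair_big_dep xpredT adj (fun _ _ => 1)) /=.
rewrite big_enum /=; apply: eq_bigr => x _.
by rewrite -sum1_count big_enum_cond; apply: eq_bigl.
Qed.

(* The 4-cycle x b y d is stored as ((x, y), (b, d)), its two diagonals. *)
Definition quad_set : {set ('I_n * 'I_n) * ('I_n * 'I_n)} :=
  [set q | [&& q.1.1 != q.1.2, q.2.1 != q.2.2,
     adj q.1.1 q.2.1, adj q.2.1 q.1.2, adj q.1.2 q.2.2 & adj q.2.2 q.1.1]].

Lemma labelled_C4_quad : labelled_C4 adj (enum 'I_n) = #|quad_set|.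
Proof.
(* The factor [k * (k - 1)] counts ordered pairs [(b, d)] of distinct common neighbours of [x] and
   [y]. *)
transitivity (\sum_x \sum_(y | y != x) \sum_(b | adj x b && adj y b)
    \sum_(d | (adj x d && adj y d) && (d != b)) 1).
  rewrite /labelled_C4 big_enum /=; apply: eq_bigr => x _.
  rewrite big_enum_cond; apply: eq_bigr => y _.
  rewrite (card_offdiag [pred z | adj x z && adj y z]).
  have -> // : codeg adj (enum 'I_n) x y = #|[pred z | adj x z && adj y z]|.
  by rewrite /codeg -sum1_count big_enum_cond sum1_card.
rewrite pair_big_dep /=.
under eq_bigr do rewrite pair_big_dep /=.
rewrite pair_big_dep /= sum1dep_card; apply: eq_card => -[[a c] [b d]].
rewrite !inE /= [c == a]eq_sym [d == b]eq_sym [adj d a]adjC [adj b c]adjC.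
by case: (a == c); case: (b == d); case: (adj a b); case: (adj c b); case: (adj c d); case: (adj a d).
Qed.

Lemma in_cyc4 (x y a b c d : 'I_n) : ([set x; y] \in cyc4 a b c d) =
  [|| (x == a) && (y == b), (x == b) && (y == a),
      (x == b) && (y == c), (x == c) && (y == b),
      (x == c) && (y == d), (x == d) && (y == c),
      (x == d) && (y == a) | (x == a) && (y == d)].
Proof. by rewrite !inE !set2_eq -!orbA. Qed.

Definition quad_cycle (q : ('I_n * 'I_n) * ('I_n * 'I_n)) : graph n :=
  cyc4 q.1.1 q.2.1 q.1.2 q.2.2.

(** The orbit under the dihedral group of order 8, which reverses either diagonal and exchanges the
    two. *)
Definition quad_orbit (a b c d : 'I_n) : seq (('I_n * 'I_n) * ('I_n * 'I_n)) :=
  [:: (a, c, (b, d)); (a, c, (d, b)); (c, a, (b, d)); (c, a, (d, b));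
      (b, d, (a, c)); (b, d, (c, a)); (d, b, (a, c)); (d, b, (c, a))].

Section Orbit.

Variables a b c d : 'I_n.
Hypothesis Uabcd : uniq [:: a; b; c; d].

Let neqs : [&& a != b, a != c, a != d, b != c, b != d & c != d].
Proof. by move: Uabcd; rewrite /= !inE !negb_or -!andbA andbT. Qed.

Let neqE : ((a == b = false) * (a == c = false) * (a == d = false) *
  (b == c = false) * (b == d = false) * (c == d = false) *
  (b == a = false) * (c == a = false) * (d == a = false) *
  (c == b = false) * (d == b = false) * (d == c = false))%type.
Proof.
rewrite ![b == a]eq_sym ![c == a]eq_sym ![d == a]eq_sym ![c == b]eq_sym ![d == b]eq_sym.
rewrite ![d == c]eq_sym.
by case/and5P: neqs => /negbTE-> /negbTE-> /negbTE-> /negbTE-> /andP[/negbTE-> /negbTE->].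
Qed.

Lemma uniq_quad_orbit : uniq (quad_orbit a b c d).
Proof. by rewrite /= !inE !xpair_eqE !neqE !andbF. Qed.

Lemma quad_cycle_orbit q :
  q \in quad_orbit a b c d -> quad_cycle q = cyc4 a b c d.
Proof.
rewrite !inE /quad_cycle.
do 7?case/predU1P=> [->|] /=; last move=> /eqP-> /=.
all: rewrite /cyc4 ?(setUC [set b] [set a]) ?(setUC [set c] [set b])
  ?(setUC [set d] [set c]) ?(setUC [set a] [set d]).
all: by apply/setP => e; rewrite !inE -!orbA; do 4 case: (e == _).
Qed.

(** Once the edge [xy] is placed on the cycle, [z] is the other neighbour of [y] and [t] the other
    neighbour of [x]. *)
Lemma quad_orbit_complete x y z t : x != z -> y != t ->
  cyc4 x y z t = cyc4 a b c d -> (x, z, (y, t)) \in quad_orbit a b c d.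
Proof.
move=> xz yt eqS.
have: [set x; y] \in cyc4 a b c d by rewrite -eqS in_cyc4 !eqxx.
have: [set y; z] \in cyc4 a b c d by rewrite -eqS in_cyc4 !eqxx ?orbT.
have: [set t; x] \in cyc4 a b c d by rewrite -eqS in_cyc4 !eqxx ?orbT.
rewrite !in_cyc4 => tx yz xy; rewrite !inE !xpair_eqE.
move: xy yz tx xz yt.
do 7?case/orP; case/andP=> /eqP-> /eqP->; rewrite !neqE !eqxx /= ?andbF ?orbF /=.
all: rewrite ?andbT => /orP[] /eqP-> /orP[] /eqP->.
all: by rewrite ?eqxx ?neqE.
Qed.

Lemma quad_orbit_neq q :
  q \in quad_orbit a b c d -> (q.1.1 != q.1.2) && (q.2.1 != q.2.2).
Proof.
by rewrite !inE; do 7?case/predU1P=> [->|] /=; last move=> /eqP-> /=; rewrite !neqE.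
Qed.

End Orbit.

Lemma quad_set_numC4 : #|quad_set| = numC4 E * 8.
Proof.
apply: (card_fibres (f := quad_cycle)) => [[[a c] [b d]]|S].
  rewrite !inE /= => /and5P[ac bd ab bc /andP[cd da]]; apply/andP; split.
    by apply/subsetP => e; rewrite !inE -!orbA => /or4P[] /eqP->.
  apply/existsP; exists a; apply/existsP; exists b.
  apply/existsP; exists c; apply/existsP; exists d.
  rewrite eqxx andbT /= !inE !negb_or ac bd.
  by rewrite (adj_neq ab) (adj_neq bc) (adj_neq cd) eq_sym (adj_neq da).
rewrite inE => /andP[SE /existsP[a /existsP[b /existsP[c /existsP[d /andP[U /eqP S_cyc]]]]]].
rewrite -[RHS]/(size (quad_orbit a b c d)) -(card_uniqP (uniq_quad_orbit U)).
apply: eq_card => q; rewrite inE; apply/andP/idP => [[]|q_abcd].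
  case: q => [[x z] [y t]]; rewrite inE S_cyc => /and3P[xz yt _] /eqP.
  exact: quad_orbit_complete.
rewrite S_cyc (quad_cycle_orbit q_abcd) eqxx; split=> //.
have qE : quad_cycle q \subset E by rewrite (quad_cycle_orbit q_abcd) -S_cyc.
have adjS x y : [set x; y] \in quad_cycle q -> adj x y by move/(subsetP qE).
have /andP[xz yt] := quad_orbit_neq U q_abcd.
rewrite inE xz yt /=; apply/and4P.
by split; apply: adjS; rewrite in_cyc4 !eqxx ?orbT.
Qed.

Lemma labelled_C4_numC4 : labelled_C4 adj (enum 'I_n) = numC4 E * 8.
Proof. by rewrite labelled_C4_quad quad_set_numC4. Qed.

End Graph.

(** * Running the search *)

(** The values ex(n, C4), established for n from 6 to 13 in [exC4_turan]. *)
Definition turan n := nth 0 [:: 0; 0; 1; 3; 4; 6; 7; 9; 11; 13; 16; 18; 21; 24] n.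

Definition level_ok n (L : seq matrix) : bool :=
  if n < 12 then
    all (fun M => (codeg_sum_diag M + 8 <= codeg_sum M) || (degree_sum M <= 2 * turan n)) L
  else nilp L.

Fixpoint search k n (L : seq matrix) : bool :=
  level_ok n L && if k is k'.+1 then search k' n.+1 (next_level n L) else true.

Lemma search_ok : search 13 0 [:: [::]].
(* The whole search runs once, when the kernel checks this cast. *)
Proof. by vm_cast_no_check (erefl true). Qed.

Section Cover.

Variables (V : eqType) (e : rel V).
Hypotheses (eC : symmetric e) (exx : irreflexive e).

Lemma search_covers k n L : n + k <= 13 -> search k n L -> covers e n L ->
  forall i, n <= i <= n + k -> exists2 L', level_ok i L' & covers e i L'.
Proof.
elim: k n L => [|k IHk] n L nk /= /andP[okL sch] covL i /andP[ni ink].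
  by exists L; rewrite (_ : i = n) //; lia.
have [<-|n_i] := eqVneq n i; first by exists L.
apply: (IHk _ _ _ sch); [lia | | lia].
apply: next_level_covers => //.
(* The averaging condition is checked entry by entry on the table. *)
have: all (fun n => (min_edges n == 0) ||
  (n.+1 * (min_edges n).-1 < n.-1 * min_edges n.+1)) (iota 0 13) by [].
by move/allP; apply; rewrite mem_iota; lia.
Qed.

Lemma covers0 : covers e 0 [:: [::]].
Proof. by move=> s _ /size0nil-> _ _; exists [::]; rewrite ?mem_head. Qed.

Lemma covers_level n : n <= 13 -> exists2 L, level_ok n L & covers e n L.
Proof. by move=> n13; apply: (search_covers _ search_ok covers0). Qed.

End Cover.

Lemma simple_graph_level n (E : graph n) : n <= 13 -> simple_graph E ->
  numC4 E <= 1 -> min_edges n <= gsize E ->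
  exists L t, [/\ level_ok n L, perm_eq t (enum 'I_n) & adjmx (adj E) t \in L].
Proof.
move=> n13 sE E1 mE.
have [L okL covL] := covers_level (adjC E) (adjxx sE) n13.
have := covL _ (enum_uniq _) (size_enum_ord n).
rewrite (edges_gsize sE) (labelled_C4_numC4 sE) => /(_ mE)[|t t_enum tL]; first by lia.
by exists L, t.
Qed.

(** A C4-free counterexample would have enough edges to appear in level [n], where [level_ok] rules
    it out. *)
Lemma numC4_gt0 n (E : graph n) : 6 <= n <= 11 -> simple_graph E ->
  turan n < gsize E -> 0 < numC4 E.
Proof.
move=> /andP[n6 n11] sE tE; rewrite lt0n; apply/negP => /eqP E0.
have n13 : n <= 13 by lia.
have mE : min_edges n <= gsize E.
  apply: leq_trans tE.
  have: all (fun n => min_edges n <= (turan n).+1) (iota 0 14) by [].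
  by move/allP; apply; rewrite mem_iota; lia.
have [|L [t [okL t_enum tL]]] := simple_graph_level n13 sE _ mE; first by rewrite E0.
have Ut : uniq t by rewrite (perm_uniq t_enum) enum_uniq.
move: okL; rewrite /level_ok ltnS n11 => /allP/(_ _ tL) /=.
rewrite (codeg_sumE _ Ut) (degree_sum_edges (adjC E) (adjxx sE)).
rewrite (perm_edges (adjC E) (adjxx sE) t_enum) (perm_labelled_C4 _ t_enum).
rewrite (edges_gsize sE) (labelled_C4_numC4 sE) E0 mul0n add0n -muln2.
by move: (codeg_sum_diag _) (gsize E) (turan n) tE => w g m; lia.
Qed.

Lemma numC4_gt1 n (E : graph n) : 12 <= n <= 13 -> simple_graph E ->
  turan n < gsize E -> 1 < numC4 E.
Proof.
move=> /andP[n12 n13] sE tE; rewrite ltnNge; apply/negP => E1.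
have mE : min_edges n <= gsize E.
  (* Here [min_edges n] is exactly [(turan n).+1]. *)
  by apply: leq_trans tE; have [->|->] : n = 12 \/ n = 13 by lia.
have [L [t [okL t_enum tL]]] := simple_graph_level n13 sE E1 mE.
by move: okL tL; rewrite /level_ok ltnNge n12 /= => /nilP->.
Qed.

(** * Examples and conclusion *)

Definition edge_rel (el : seq (nat * nat)) : rel nat :=
  fun i j => (i != j) && (((i, j) \in el) || ((j, i) \in el)).

Definition edge_graph n el : graph n :=
  [set [set p.1; p.2] | p : 'I_n * 'I_n & edge_rel el p.1 p.2].

(** Indexed by plain naturals, so that examples are evaluated without finite sets or ordinals. *)
Definition edge_mx n el : matrix :=
  [seq [seq edge_rel el i j | j <- iota 0 n] | i <- iota 0 n].

Lemma edge_graph_simple n el : simple_graph (edge_graph n el).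
Proof.
apply/forall_inP => S /imsetP[[x y]]; rewrite inE /= => /andP[xy _] ->.
by rewrite cards2 xy.
Qed.

Lemma adj_edge_graph n el x y : adj (edge_graph n el) x y = edge_rel el x y.
Proof.
apply/imsetP/idP => [[[z t]]|xy]; last by exists (x, y); rewrite ?inE.
rewrite inE /= => zt /eqP; rewrite set2_eq => /orP[/andP[/eqP-> /eqP->] //|].
by move=> /andP[/eqP-> /eqP->]; rewrite /edge_rel eq_sym orbC.
Qed.

Lemma adjmx_edge_graph n el : adjmx (adj (edge_graph n el)) (enum 'I_n) = edge_mx n el.
Proof.
rewrite /adjmx /edge_mx -val_enum_ord -map_comp; apply: eq_map => x /=.
by rewrite -map_comp; apply: eq_map => y /=; rewrite adj_edge_graph.
Qed.

Lemma gsize_edge_graph n el m : degree_sum (edge_mx n el) = 2 * m -> gsize (edge_graph n el) = m.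
Proof.
have sE := edge_graph_simple n el.
rewrite -adjmx_edge_graph (degree_sum_edges (adjC _) (adjxx sE)) (edges_gsize sE).
by rewrite mul2n => /double_inj.
Qed.

Lemma numC4_edge_graph n el c :
  codeg_sum (edge_mx n el) = codeg_sum_diag (edge_mx n el) + 8 * c ->
  numC4 (edge_graph n el) = c.
Proof.
have sE := edge_graph_simple n el.
rewrite -adjmx_edge_graph (codeg_sumE _ (enum_uniq _)) (labelled_C4_numC4 sE).
by rewrite addnC mulnC => /addnI/eqP; rewrite eqn_pmul2l // => /eqP.
Qed.

(* Entry [n - 6] is a graph of size ex(n, C4) + 1, obtained by adding its first
   edge to an extremal C4-free graph; for [n = 13] the latter is the polarity
   graph of the projective plane of order 3, and for [n = 12] this graph minus a
   vertex of degree 3. *)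
Definition example n : seq (nat * nat) :=
  nth [::] [::
   [:: (0, 3); (1, 3); (0, 4); (2, 4); (1, 5); (2, 5); (3, 5); (4, 5)];
   [:: (3, 4); (0, 3); (1, 4); (0, 5); (2, 5); (3, 5); (1, 6); (2, 6); (4, 6); (5, 6)];
   [:: (2, 3); (1, 2); (1, 3); (0, 4); (1, 4); (2, 5); (3, 6); (5, 6); (0, 7); (4, 7);
       (5, 7); (6, 7)];
   [:: (2, 3); (2, 4); (3, 5); (4, 5); (0, 6); (2, 6); (3, 6); (1, 7); (4, 7); (5, 7);
       (0, 8); (1, 8); (6, 8); (7, 8)];
   [:: (6, 7); (0, 1); (0, 2); (0, 3); (1, 4); (1, 5); (2, 6); (4, 6); (2, 7); (5, 7);
       (3, 8); (4, 8); (6, 8); (3, 9); (5, 9); (7, 9); (8, 9)];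
   [:: (6, 7); (1, 2); (1, 3); (0, 5); (1, 5); (4, 5); (2, 6); (4, 6); (3, 7); (4, 7);
       (0, 8); (5, 8); (2, 9); (6, 9); (8, 9); (3, 10); (7, 10); (8, 10); (9, 10)];
   [:: (2, 6); (0, 1); (2, 3); (0, 4); (1, 4); (2, 4); (3, 4); (1, 5); (1, 6); (5, 6);
       (0, 7); (2, 8); (5, 8); (0, 9); (7, 9); (8, 9); (2, 10); (6, 10); (7, 10); (3, 11);
       (5, 11); (7, 11)];
   [:: (8, 9); (0, 1); (2, 3); (0, 4); (1, 4); (2, 4); (3, 4); (1, 5); (1, 6); (5, 6);
       (0, 7); (3, 8); (6, 8); (2, 9); (5, 9); (0, 10); (7, 10); (8, 10); (9, 10); (2, 11);
       (6, 11); (7, 11); (3, 12); (5, 12); (7, 12)]] (n - 6).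

Definition is_example n el m c : bool :=
  let M := edge_mx n el in
  (degree_sum M == 2 * m) && (codeg_sum M == codeg_sum_diag M + 8 * c).

Lemma is_exampleP n el m c : is_example n el m c ->
  [/\ simple_graph (edge_graph n el), gsize (edge_graph n el) = m
    & numC4 (edge_graph n el) = c].
Proof.
move=> /andP[/eqP m_el /eqP c_el]; split; first exact: edge_graph_simple.
  exact: gsize_edge_graph.
exact: numC4_edge_graph.
Qed.

(** Dropping the first edge leaves the C4-free graph that bounds ex(n, C4) from below. *)
Lemma example_ok n : 6 <= n <= 13 ->
  is_example n (example n) (turan n).+1 (if n < 12 then 1 else 2) &&
  is_example n (behead (example n)) (turan n) 0.
Proof.
move=> n613.
have: all (fun n => is_example n (example n) (turan n).+1 (if n < 12 then 1 else 2) &&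
  is_example n (behead (example n)) (turan n) 0) (iota 6 8) by vm_compute.
by move/allP; apply; rewrite mem_iota; lia.
Qed.

Lemma exC4_turan n : 6 <= n <= 13 -> exC4 n = turan n.
Proof.
move=> n613; apply/eqP; rewrite eqn_leq; apply/andP; split.
  apply/bigmax_leqP => E /andP[sE /eqP E0]; rewrite leqNgt; apply/negP => tE.
  have [n11|n12] := leqP n 11.
    by have := @numC4_gt0 n E; rewrite E0 => /(_ _ sE tE); lia.
  by have := @numC4_gt1 n E; rewrite E0 => /(_ _ sE tE); lia.
have /andP[_ /is_exampleP[sE szE E0]] := example_ok n613.
by rewrite -szE leq_bigmax_cond // sE E0.
Qed.

Theorem theorem5 :
  (forall n : nat, 6 <= n <= 11 ->
     exists E : graph n,
       [/\ simple_graph E, gsize E = (exC4 n).+1 & numC4 E = 1])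
  /\
  (forall n : nat, (n == 12) || (n == 13) ->
     (exists E : graph n,
        [/\ simple_graph E, gsize E = (exC4 n).+1 & numC4 E = 2])
     /\
     (forall E : graph n, simple_graph E -> gsize E = (exC4 n).+1 ->
        2 <= numC4 E)).
Proof.
split=> n n_range.
  have n613 : 6 <= n <= 13 by lia.
  have /andP[/is_exampleP ex_n _] := example_ok n613.
  exists (edge_graph n (example n)); rewrite exC4_turan //.
  by move: ex_n; rewrite ifT //; lia.
have n613 : 6 <= n <= 13 by lia.
rewrite exC4_turan //; split.
  have /andP[/is_exampleP ex_n _] := example_ok n613.
  exists (edge_graph n (example n)).
  by move: ex_n; rewrite ifF //; lia.
move=> E sE szE; apply: numC4_gt1 => //; [lia | by rewrite szE].
Qed.
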